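(* Let $a<b$ be integers and let $f:[a,b]\to\mathbb R$ be a function of bounded variation. Then $$\sum_{a\le k<b}f(k)=\int_a^b f(x)\,dx-\frac12\big(f(b)-f(a)\big)+R,\qquad |R|\le\frac12\,\mathrm{pV}(f,[a,b]),$$ that is, the real number $R$ defined by the equality on the left satisfies the inequality on the right.
   Context: For a real-valued function $f$ on an interval $I$, the pointwise variation of $f$ on $I$ is $$\mathrm{pV}(f,I):=\sup\Big\{\sum_{0\le i<n}|f(t_{i+1})-f(t_i)|:\ t_i\in I,\ t_0<t_1<\dots<t_n\Big\},$$ and $f$ is of bounded variation on $I$ if $\mathrm{pV}(f,I)<+\infty$. For integers $a<b$, $\sum_{a\le k<b}f(k)$ denotes $\sum_{k=a}^{b-1}f(k)$, the sum over integers $k$. Functions of bounded variation are locally integrable, so the integral is well defined. *)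

(* Defs.v *)
From HB Require Import structures.
From mathcomp Require Import all_boot all_order all_algebra.
From mathcomp Require Import all_classical all_reals all_analysis.

Set Implicit Arguments.
Unset Strict Implicit.
Unset Printing Implicit Defensive.

Import Order.TTheory GRing.Theory Num.Theory.
Import numFieldNormedType.Exports.

Local Open Scope classical_set_scope.
Local Open Scope ring_scope.

(* The library's [total_variation] is restricted to compact intervals and to
   subdivisions containing both endpoints; here I is any interval and the
   subdivision points are arbitrary points of I. Only t 0, ..., t n matter. *)
Definition pV (R : realType) (f : R -> R) (I : interval R) : \bar R :=
  ereal_sup [set v : \bar R | exists (n : nat) (t : nat -> R),
    [/\ forall i, (i <= n)%N -> t i \in I,
        forall i, (i < n)%N -> t i < t i.+1
      & v = (\sum_(0 <= i < n) `|f (t i.+1) - f (t i)|)%:E]].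

Definition has_bounded_variation (R : realType) (f : R -> R)
    (I : interval R) : Prop :=
  (pV f I < +oo)%E.

(* f a + f (a + 1) + ... + f (b - 1), for a <= b. *)
Definition sum_int (R : realType) (f : R -> R) (a b : int) : R :=
  \sum_(0 <= i < `|b - a|%N) f (a + i%:Z)%:~R.

(* Main.v *)
(* R is the error of the trapezoidal rule with unit steps: R is the sum over k
   of (f(k) + f(k+1))/2 minus the integral of f over [k, k+1]. At a point x of
   [k, k+1] the integrand differs from (f(k) + f(k+1))/2 by at most
   (|f(x) - f(k)| + |f(k+1) - f(x)|)/2, hence by at most half the variation of f
   on [k, k+1]; these variations add up over k. *)
Require Import Defs.
From mathcomp Require Import all_boot all_order all_algebra.
From mathcomp Require Import all_classical all_reals all_analysis.
From mathcomp Require Import measurable_realfun lra ring.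

Set Implicit Arguments.
Unset Strict Implicit.

Import Order.TTheory GRing.Theory Num.Theory.
Import numFieldNormedType.Exports.

Local Open Scope classical_set_scope.
Local Open Scope ring_scope.

(** The rays [[r, +oo[] generate the Borel sets, and by monotonicity the part of [i] that [f] sends
    into such a ray is an interval. *)
Lemma nondecreasing_in_itv_measurable (R : realType) (i : interval R)
    (f : R -> R) :
  {in i &, nondecreasing_fun f} -> measurable_fun [set` i] f.
Proof.
move=> ndf; apply: (measurability (@RGenCInfty.G R)) => [|_ [_] [r] -> <-].
  exact: RGenCInfty.measurableE.
apply: is_interval_measurable => s t /= [si rs] [ti _] u sut.
have ui : u \in i by exact: (interval_is_interval si ti).
split => //; move: rs; rewrite /= !in_itv/= !andbT => rs.
by rewrite (le_trans rs)// ndf//; case/andP: sut.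
Qed.

(** Lets the additivity and the Jordan decomposition known for [total_variation] be applied to a
    function with finite [pV]. *)
Lemma total_variation_le_pV (R : realType) (a b : R) (f : R -> R) :
  (total_variation a b f <= pV f `[a, b])%E.
Proof.
apply: ge_ereal_sup => _ [_ [s abs <-] <-]; apply: ereal_sup_ubound.
(* The default [b] is the one in the definition of [variation], so the two sums agree by
   computation. *)
exists (size s), (nth b (a :: s)); split => //.
- move=> i ile; rewrite in_itv/=; apply/andP; split.
    exact: itv_partition_nth_ge.
  exact: itv_partition_nth_le.
- by case: abs => /(pathP b) h _ i ilt; exact: h.
Qed.

(** Used twice: to bound [f] on the interval, and for the pointwise estimate behind the trapezoidal
    rule. *)
Lemma total_variation_ge_mid (R : realType) (a b x : R) (f : R -> R) :
  x \in `[a, b] ->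
  (`|f x - f a|%:E + `|f b - f x|%:E <= total_variation a b f)%E.
Proof.
rewrite in_itv/= => /andP[ax xb].
by rewrite (total_variationD _ ax xb) leeD// total_variation_ge.
Qed.

Lemma bounded_variation_integrable (R : realType) (a b : R) (f : R -> R) :
  a <= b -> bounded_variation a b f ->
  (@lebesgue_measure R).-integrable `[a, b] (EFin \o f).
Proof.
move=> ab bvf.
have TVfin : total_variation a b f \is a fin_num by apply/bounded_variationP.
apply: measurable_bounded_integrable => //=.
- by rewrite lebesgue_measure_itv/=; case: ifP => _; rewrite -?EFinB ltry.
(* Jordan decomposition: [f] is a difference of two nondecreasing functions. Since [pos_tv] of [f]
   is [neg_tv] of [\- f], one monotonicity lemma serves both. *)
- apply: (eq_measurable_fun ((fine \o pos_tv a f) \- (fine \o neg_tv a f))).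
    move=> x xab.
    by rewrite (bounded_variation_pos_neg_tvE bvf)//; exact: set_mem.
  by apply: measurable_funB; apply: nondecreasing_in_itv_measurable;
    apply: fine_neg_tv_nondecreasing => //; exact: bounded_variationN.
- exists (`|f a| + fine (total_variation a b f)); split; first exact: num_real.
  move=> M ltM x /= xab; apply/ltW/(le_lt_trans _ ltM).
  have := total_variation_ge_mid f xab.
  rewrite -(fineK TVfin) -EFinD lee_fin => h.
  have := ler_normD (f x - f a) (f a); rewrite subrK.
  by have := normr_ge0 (f b - f x); lra.
Qed.

Lemma trapezoid_error (R : realType) (a b : R) (f : R -> R) :
  a <= b -> bounded_variation a b f ->
  `|\int[lebesgue_measure]_(x in `[a, b]) f x - (b - a) * (2^-1 * (f a + f b))|
    <= (b - a) * (2^-1 * fine (total_variation a b f)).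
Proof.
move=> ab bvf; have intf := bounded_variation_integrable ab bvf.
have TVfin : total_variation a b f \is a fin_num by apply/bounded_variationP.
have muab : (lebesgue_measure `[a, b]%classic = (b - a)%:E)%E.
  rewrite lebesgue_measure_itv/= lte_fin.
  by case: ltgtP ab => // -> _; rewrite subrr.
have intc r : lebesgue_measure.-integrable `[a, b] (EFin \o @cst R R r).
  by apply: bounded_variation_integrable => //;
    exact: nondecreasing_bounded_variation.
(* Read from right to left, this turns both the trapezoid term and the bound into integrals, so that
   it suffices to compare integrands. *)
have cstE r : \int[lebesgue_measure]_(x in `[a, b]) r = (b - a) * r.
  by rewrite Rintegral_cst// mulrC; congr (_ * _); rewrite [X in fine X]muab.
rewrite -!cstE -RintegralB//; last exact: intc.
have intd : lebesgue_measure.-integrable `[a, b]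
    (EFin \o (fun x => f x - 2^-1 * (f a + f b))).
  by apply: (integrableB _ intf (intc _)).
apply: le_trans (le_normr_Rintegral _ intd) _ => //.
apply: le_Rintegral => //.
- exact: integrable_norm.
- exact: intc.
move=> x /= xab; have := total_variation_ge_mid f xab.
rewrite -(fineK TVfin) -EFinD lee_fin /=.
have -> : f x - 2^-1 * (f a + f b) =
  2^-1 * (f x - f a) - 2^-1 * (f b - f x) by field.
have := ler_normB (2^-1 * (f x - f a)) (2^-1 * (f b - f x)).
by rewrite !normrM gtr0_norm ?invr_gt0//; lra.
Qed.

(** Induction on the number of unit steps: the integral and the total variation are both additive
    when the last step is split off. *)
Lemma composite_trapezoid_error (R : realType) (a : R) (n : nat) (f : R -> R) :
  bounded_variation a (a + n%:R) f ->
  `|\int[lebesgue_measure]_(x in `[a, a + n%:R]) f x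
    - \sum_(0 <= i < n) 2^-1 * (f (a + i%:R) + f (a + i.+1%:R))|
    <= 2^-1 * fine (total_variation a (a + n%:R) f).
Proof.
elim: n => [|n IHn] bvf.
  by rewrite big_geq// addr0 set_itv1 Rintegral_set1 subr0 normr0
    total_variationxx mulr0.
have le1 : a <= a + n%:R by rewrite lerDl.
have le2 : a + n%:R <= a + n.+1%:R by rewrite lerD2l ler_nat.
have bv1 := bounded_variationl le1 le2 bvf.
have bv2 := bounded_variationr le1 le2 bvf.
have intf := bounded_variation_integrable (le_trans le1 le2) bvf.
have step : a + n.+1%:R - (a + n%:R) = 1 by rewrite -natr1; ring.
have := IHn bv1; have := trapezoid_error le2 bv2.
rewrite step !mul1r big_nat_recr//= (total_variationD _ le1 le2).
rewrite fineD; try exact/bounded_variationP.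
(* The difference of the two integrals is one over an interval open on the left; adding its left
   endpoint, a null set, does not change it. *)
have := @Rintegral_itvB R f (BLeft a) (BRight (a + n.+1%:R)) (a + n%:R) intf.
rewrite !bnd_simp => /(_ le1 le2).
rewrite Rintegral_itv_obnd_cbnd; last first.
  apply: integrableS intf => //; apply: subset_itvr.
  by rewrite bnd_simp.
move=> <-; set I := Rintegral _ _ _; set J := Rintegral _ _ _.
set S := \sum_(_ <= _ < _) _; set T := _ * (_ + _).
move=> h1 h2; have := ler_normD (J - S) (I - J - T).
have -> : J - S + (I - J - T) = I - (S + T) by ring.
lra.
Qed.

(* f is total on R, but only its values on [a, b] occur below. *)
Theorem theorem2p1 (R : realType) (a b : int) (f : R -> R) :
  a < b ->
  has_bounded_variation f `[a%:~R, b%:~R] ->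
  forall r : R,
    sum_int f a b =
      \int[lebesgue_measure]_(x in `[a%:~R, b%:~R]) f x
        - 2^-1 * (f b%:~R - f a%:~R) + r ->
    (`|r|%:E <= 2^-1%:E * pV f `[a%:~R, b%:~R])%E.
Proof.
move=> ab pVfin r.
have TVle := total_variation_le_pV a%:~R b%:~R f.
have abR : a%:~R <= b%:~R :> R by rewrite ler_int ltW.
have TVfin : total_variation a%:~R b%:~R f \is a fin_num.
  by rewrite ge0_fin_numE ?total_variation_ge0// (le_lt_trans TVle).
have := TVfin => /(bounded_variationP _ abR) bvf rE.
apply: (@le_trans _ _ (2^-1%:E * total_variation a%:~R b%:~R f)%E); last first.
  by apply: lee_wpmul2l => //; rewrite lee_fin invr_ge0.
rewrite -(fineK TVfin) -EFinM lee_fin.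
set n := `|b - a|%N.
have bE : b%:~R = a%:~R + n%:R :> R.
  rewrite [n%:R]pmulrn -intrD /n gez0_abs ?subr_ge0 ?(ltW ab)//.
  by rewrite [a + _]addrC subrK.
have := @composite_trapezoid_error R a%:~R n f; rewrite -bE => /(_ bvf).
(* Each trapezoid is its left value plus half an increment of [f], and the increments telescope.
   Hence integral minus trapezoids is [- r]. *)
suff -> : \sum_(0 <= i < n) 2^-1 * (f (a%:~R + i%:R) + f (a%:~R + i.+1%:R)) =
    sum_int f a b + 2^-1 * (f b%:~R - f a%:~R).
  rewrite rE; set I := Rintegral _ _ _; set d := 2^-1 * _.
  have -> : I - (I - d + r + d) = - r by ring.
  by rewrite normrN.
have -> : f b%:~R - f a%:~R =
    \sum_(0 <= i < n) (f (a%:~R + i.+1%:R) - f (a%:~R + i%:R)).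
  by rewrite (telescope_sumr (fun i => f (a%:~R + i%:R)))// addr0 -bE.
rewrite /sum_int -/n mulr_sumr -big_split/=; apply: eq_bigr => i _.
by rewrite intrD -pmulrn; field.
Qed.
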